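(* Let $r\ge 0$ and let $S\subseteq\{0,1,2,\ldots,r\}$ be a subset containing both $0$ and $r$. Then the adjunction $\mathcal{L}\dashv\mathrm{Tot}^{\Pi}$, with left adjoint $\mathcal{L}\colon (f\mathcal{C})_S\to(b\mathcal{C})_S$ and right adjoint $\mathrm{Tot}^{\Pi}\colon(b\mathcal{C})_S\to(f\mathcal{C})_S$, is a Quillen equivalence.
   Context: Conventions: $R$ is a fixed commutative unital ring. Filtered chain complexes. A filtered chain complex $A$ is a cohomologically graded chain complex of $R$-modules (differential $d$ of degree $+1$) with an increasing filtration by subcomplexes $F_pA\subseteq F_{p+1}A\subseteq A$, $p\in\mathbb{Z}$. Morphisms are chain maps $f$ with $f(F_pA)\subseteq F_pB$. The category is $f\mathcal{C}$. For $k\ge 0$ the $k$-cycles are $Z_k^{p,p+n}(A)=F_pA^n\cap d^{-1}F_{p-k}A^{n+1}$; the $k$-boundaries are $B_0^{p,p+n}(A)=F_{p-1}A^n$ and, for $k\ge1$, $B_k^{p,p+n}(A)=dZ_{k-1}^{p+k-1,p+k-1+n-1}(A)+Z_{k-1}^{p-1,p-1+n}(A)$; the $k$-page is $E_k^{p,p+n}(A)=Z_k^{p,p+n}(A)/B_k^{p,p+n}(A)$. A morphism is an $r$-weak equivalence if it induces an isomorphism on $E_{r+1}^{p,p+n}$ for all $p,n\in\mathbb{Z}$. With $r=\max S$, $(f\mathcal{C})_S$ is the (known) cofibrantly generated model structure on $f\mathcal{C}$ whose weak equivalences are the $r$-weak equivalences and whose fibrations are the morphisms $f$ with $Z_s^{p,p+n}(f)$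 surjective for all $p,n\in\mathbb{Z}$ and all $s\in S$. Bicomplexes. A bicomplex $A$ is a collection of $R$-modules $A^{i,j}$ ($i,j\in\mathbb{Z}$) with differentials $d_0\colon A^{i,j}\to A^{i,j+1}$, $d_1\colon A^{i,j}\to A^{i-1,j}$, $d_0d_0=0$, $d_1d_1=0$, $d_0d_1=d_1d_0$. The category is $b\mathcal{C}$. The product totalisation $\mathrm{Tot}^{\Pi}\colon b\mathcal{C}\to f\mathcal{C}$ is $\mathrm{Tot}^{\Pi}(A)^n=\prod_{i}A^{i,i+n}$, $F_p\mathrm{Tot}^{\Pi}(A)^n=\prod_{i\le p}A^{i,i+n}$, with differential $(a_i)_i\mapsto(d_0a_i+(-1)^nd_1a_{i+1})_i$. The spectral sequence of a bicomplex is that of $\mathrm{Tot}^{\Pi}(A)$, and a morphism of $b\mathcal{C}$ is an $r$-weak equivalence if it induces an isomorphism on $(r+1)$-pages. The $k$-witness cycles are $ZW_0^{p,p+n}(A)=A^{p,p+n}$ and, for $k\ge1$, $ZW_k^{p,p+n}(A)=\{(a_0,\dots,a_{k-1})\in\bigoplus_{j=0}^{k-1}A^{p-j,p+n-j}\mid d_0a_0=0,\ d_0a_j=d_1a_{j-1}\text{ for }j\ge1\}$. With $r=\max S$ and $0\in S$, $(b\mathcal{C})_S$ is the (known) cofibrantly generated model structure on $b\mathcal{C}$ whose weak equivalences are the $r$-weak equivalences and whose fibrations are the morphisms $f$ with $ZW_s^{p,p+n}(f)$ surjective for all $p,n$ and all $s\in S$. The functor $\mathcal{L}\colon f\mathcal{C}\to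 b\mathcal{C}$ is $\mathcal{L}(A)^{i,i+n}=A^n/F_{i-1}A^n\oplus A^{n-1}/F_iA^{n-1}$ with $d_0(x,y)=(dx,x-dy)$ and $d_1(x,y)=(0,(-1)^{n+1}x)$ for $(x,y)\in\mathcal{L}(A)^{i,i+n}$; on morphisms it is the induced map on quotients. It is left adjoint to $\mathrm{Tot}^{\Pi}$: a morphism $f\colon\mathcal{L}(A)\to B$ corresponds to $A\to\mathrm{Tot}^{\Pi}(B)$, $a\mapsto (f^{i,i+n}([a],0))_i$ for $a\in A^n$. *)

(* Defs.v *)
From HB Require Import structures.
From mathcomp Require Import all_boot all_order all_algebra.
From mathcomp Require Import boolp zify.

Set Implicit Arguments.
Unset Strict Implicit.
Unset Printing Implicit Defensive.

Import Order.TTheory GRing.Theory Num.Theory.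
Local Open Scope ring_scope.
#[local] Obligation Tactic := idtac.

Record category := Category {
  obj :> Type;
  hom : obj -> obj -> Type;
  idm : forall X, hom X X;
  comp : forall X Y Z, hom Y Z -> hom X Y -> hom X Z;
  comp1m : forall X Y (f : hom X Y), comp (idm Y) f = f;
  compm1 : forall X Y (f : hom X Y), comp f (idm X) = f;
  compA : forall X Y Z W (h : hom Z W) (g : hom Y Z) (f : hom X Y),
    comp h (comp g f) = comp (comp h g) f
}.

Arguments hom {_} _ _.
Arguments idm {_} _.
Arguments comp {_ _ _ _} _ _.

Record functor (C D : category) := Functor {
  fobj :> C -> D;
  fmor : forall X Y, hom X Y -> hom (fobj X) (fobj Y);
  fmor1 : forall X, fmor (idm X) = idm (fobj X);
  fmorM : forall X Y Z (g : hom Y Z) (f : hom X Y),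
    fmor (comp g f) = comp (fmor g) (fmor f)
}.

Arguments fmor {C D} _ {X Y} _.

Record adjunction (C D : category) (F : functor C D) (G : functor D C) :=
Adjunction {
  transpose : forall X Y, hom (F X) Y -> hom X (G Y);
  transpose_bij : forall X Y, bijective (@transpose X Y);
  transpose_natl : forall X X' Y (f : hom (F X) Y) (u : hom X' X),
    transpose (comp f (fmor F u)) = comp (transpose f) u;
  transpose_natr : forall X Y Y' (f : hom (F X) Y) (v : hom Y Y'),
    transpose (comp v f) = comp (fmor G v) (transpose f)
}.

Arguments transpose {C D F G} _ {X Y} _.

Definition initial (C : category) (I : C) :=
  forall X : C, exists! f : hom I X, True.

Definition terminal (C : category) (T : C) :=
  forall X : C, exists! f : hom X T, True.

Definition retract (C : category) (X Y X' Y' : C)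
    (f : hom X Y) (g : hom X' Y') :=
  exists (i : hom X X') (p : hom X' X) (j : hom Y Y') (q : hom Y' Y),
    [/\ comp p i = idm X, comp q j = idm Y,
        comp g i = comp j f & comp f p = comp q g].

Definition lifting (C : category) (A B X Y : C)
    (i : hom A B) (p : hom X Y) :=
  forall (u : hom A X) (v : hom B Y), comp p u = comp v i ->
  exists h : hom B X, comp h i = u /\ comp p h = v.

Definition morphism_class (C : category) := forall X Y : C, hom X Y -> Prop.

(* Completeness of the category is not part of the structure. *)
Record model_structure (C : category) := ModelStructure {
  weq : morphism_class C;
  cof : morphism_class C;
  fib : morphism_class C;
  weq_comp : forall X Y Z (g : hom Y Z) (f : hom X Y),
    weq g -> weq f -> weq (comp g f);
  weq_cancell : forall X Y Z (g : hom Y Z) (f : hom X Y),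
    weq g -> weq (comp g f) -> weq f;
  weq_cancelr : forall X Y Z (g : hom Y Z) (f : hom X Y),
    weq f -> weq (comp g f) -> weq g;
  weq_retract : forall X Y X' Y' (f : hom X Y) (g : hom X' Y'),
    retract f g -> weq g -> weq f;
  cof_retract : forall X Y X' Y' (f : hom X Y) (g : hom X' Y'),
    retract f g -> cof g -> cof f;
  fib_retract : forall X Y X' Y' (f : hom X Y) (g : hom X' Y'),
    retract f g -> fib g -> fib f;
  acyclic_cof_lifting : forall A B X Y (i : hom A B) (p : hom X Y),
    cof i -> weq i -> fib p -> lifting i p;
  acyclic_fib_lifting : forall A B X Y (i : hom A B) (p : hom X Y),
    cof i -> fib p -> weq p -> lifting i p;
  factor_acyclic_cof : forall X Y (f : hom X Y),
    exists (Z : C) (i : hom X Z) (p : hom Z Y),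
      [/\ f = comp p i, cof i, weq i & fib p];
  factor_acyclic_fib : forall X Y (f : hom X Y),
    exists (Z : C) (i : hom X Z) (p : hom Z Y),
      [/\ f = comp p i, cof i, fib p & weq p]
}.

Arguments weq {C} _ {X Y} _.
Arguments cof {C} _ {X Y} _.
Arguments fib {C} _ {X Y} _.

Definition cofibrant (C : category) (M : model_structure C) (X : C) :=
  exists (I : C) (f : hom I X), initial I /\ cof M f.

Definition fibrant (C : category) (M : model_structure C) (X : C) :=
  exists (T : C) (f : hom X T), terminal T /\ fib M f.

Definition quillen_adjunction (C D : category) (M : model_structure C)
    (N : model_structure D) (F : functor C D) (G : functor D C)
    (a : adjunction F G) :=
  (forall X Y (f : hom X Y), cof M f -> cof N (fmor F f)) /\
  (forall X Y (f : hom X Y), cof M f -> weq M f ->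
     cof N (fmor F f) /\ weq N (fmor F f)).

Definition quillen_equivalence (C D : category) (M : model_structure C)
    (N : model_structure D) (F : functor C D) (G : functor D C)
    (a : adjunction F G) :=
  quillen_adjunction M N a /\
  forall (X : C) (Y : D), cofibrant M X -> fibrant N Y ->
  forall f : hom (F X) Y, weq N f <-> weq M (transpose a f).

Section Modules.
Variable R : comPzRingType.

Lemma linear_ext (V W : lmodType R) (f g : {linear V -> W}) :
  f =1 g -> f = g.
Proof.
case: f => f [[hf] [mf]]; case: g => g [[hg] [mg]] /= /funext fg.
subst g; by rewrite (Prop_irrelevance hf hg) (Prop_irrelevance mf mg).
Qed.

Definition submod_pred (V : lmodType R) (P : V -> Prop) of
  P 0 /\ (forall a u v, P u -> P v -> P (a *: u + v)) : V -> bool :=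
  fun x => `[< P x >].

Section SubmodOf.
Variables (V : lmodType R) (P : V -> Prop).
Hypothesis HP : P 0 /\ (forall a u v, P u -> P v -> P (a *: u + v)).

Lemma submod_pred_closed : subsemimod_closed (submod_pred HP).
Proof.
case: (HP) => P0 PD; split; first split.
- exact/asboolP.
- move=> x y /asboolP Px /asboolP Py; apply/asboolP.
  by rewrite -[x]scale1r; apply: PD.
- move=> a x /asboolP Px; apply/asboolP.
  by rewrite -[a *: x]addr0; apply: PD.
Qed.

HB.instance Definition _ :=
  GRing.isSubmodClosed.Build R V (submod_pred HP) submod_pred_closed.

Definition submod_of : submodClosed V :=
  GRing.SubmodClosed.clone R V (submod_pred HP) _.

Lemma submod_ofP x : reflect (P x) (x \in submod_of).
Proof. exact: asboolP. Qed.

End SubmodOf.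

Section Sub.
Variables (V : lmodType R) (U : submodClosed V).

Lemma submod_opp x : x \in U -> - x \in U.
Proof. by rewrite -scaleN1r; apply: rpredZ. Qed.

Lemma submod_sub x y : x \in U -> y \in U -> x - y \in U.
Proof. by move=> Ux Uy; apply: rpredD => //; apply: submod_opp. Qed.

Record subm := Subm { subm_val : V; subm_valP : subm_val \in U }.

HB.instance Definition _ := [isSub for subm_val].
HB.instance Definition _ := [Choice of subm by <:].
HB.instance Definition _ := [SubChoice_isSubLmodule of subm by <:].

Definition zmod_pred : V -> bool := fun x => x \in U.
Lemma zmod_pred_closed : zmod_closed zmod_pred.
Proof. split; [exact: rpred0 | exact: submod_sub]. Qed.
HB.instance Definition _ :=
  GRing.isZmodClosed.Build V zmod_pred zmod_pred_closed.

Definition zmod_of : zmodClosed V := GRing.ZmodClosed.clone V zmod_pred _.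

Definition quom := Quotient.quot zmod_of.
HB.instance Definition _ := GRing.Zmodule.on quom.

Definition qpi (x : V) : quom := (\pi_(Quotient.quot zmod_of) x)%qT.

Lemma qpiP x y : qpi x = qpi y <-> x - y \in U.
Proof.
have -> : (x - y \in U) = (x - y \in zmod_of) by [].
by rewrite Quotient.idealrBE; split=> [/eqP|/eqP].
Qed.

Lemma reprK_quom (q : quom) : qpi (repr q) = q.
Proof. exact: reprK. Qed.

Definition quom_scale (a : R) (q : quom) : quom := qpi (a *: repr q).

Lemma quom_scaleE a x : quom_scale a (qpi x) = qpi (a *: x).
Proof.
apply/qpiP; rewrite -scalerBr; apply: rpredZ; apply/qpiP; exact: reprK_quom.
Qed.

Lemma qpiD x y : qpi (x + y) = qpi x + qpi y.
Proof. exact: raddfD. Qed.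

Lemma quom_scaleA a b q :
  quom_scale a (quom_scale b q) = quom_scale (a * b) q.
Proof. by rewrite -[q]reprK_quom !quom_scaleE scalerA. Qed.

Lemma quom_scale1 : left_id 1 quom_scale.
Proof. by move=> q; rewrite -[q]reprK_quom quom_scaleE scale1r. Qed.

Lemma quom_scaleDr : right_distributive quom_scale +%R.
Proof.
move=> a q q'; rewrite -[q]reprK_quom -[q']reprK_quom.
by rewrite -qpiD !quom_scaleE scalerDr qpiD.
Qed.

Lemma quom_scaleDl q : {morph quom_scale^~ q : a b / a + b}.
Proof.
by move=> a b; rewrite -[q]reprK_quom !quom_scaleE scalerDl qpiD.
Qed.

HB.instance Definition _ := GRing.Zmodule_isLmodule.Build R quom
  quom_scaleA quom_scale1 quom_scaleDr quom_scaleDl.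

Lemma qpi_linear : linear qpi.
Proof. by move=> a x y; rewrite qpiD -quom_scaleE. Qed.
HB.instance Definition _ := GRing.isLinear.Build R V quom _ qpi qpi_linear.

End Sub.
Section Lift.
Variables (V W : lmodType R) (U : submodClosed V) (f : {linear V -> W}).
Hypothesis fU : forall x, x \in U -> f x = 0.

Definition qlift of (forall x, x \in U -> f x = 0) : quom U -> W :=
  fun q => f (repr q).

Lemma qliftE x : qlift fU (qpi U x) = f x.
Proof.
apply/eqP; rewrite -subr_eq0 -linearB; apply/eqP/fU/qpiP.
exact: reprK_quom.
Qed.

Lemma qlift_linear : linear (qlift fU).
Proof.
move=> a q q'; rewrite -[q]reprK_quom -[q']reprK_quom.
by rewrite -linearP !qliftE linearP.
Qed.
HB.instance Definition _ :=
  GRing.isLinear.Build R (quom U) W _ (qlift fU) qlift_linear.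

End Lift.

Section Maps.
Variables (V W : lmodType R) (U : submodClosed V) (U' : submodClosed W) (f : {linear V -> W}).
Hypothesis fU : forall x, x \in U -> f x \in U'.

Lemma qmap_subproof x : x \in U -> (qpi U' \o f) x = 0.
Proof.
move=> Ux /=; rewrite -(linear0 (qpi U')); apply/qpiP.
by rewrite subr0; apply: fU.
Qed.

Definition qmap : {linear quom U -> quom U'} := qlift qmap_subproof.

Lemma qmapE x : qmap (qpi U x) = qpi U' (f x).
Proof. exact: qliftE. Qed.

Definition smap_fun (x : subm U) : subm U' := Subm (fU (subm_valP x)).

Lemma smap_linear : linear smap_fun.
Proof. by move=> a x y; apply: val_inj => /=; rewrite linearP. Qed.
HB.instance Definition _ :=
  GRing.isLinear.Build R (subm U) (subm U') _ smap_fun smap_linear.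

Definition smap : {linear subm U -> subm U'} := smap_fun.

End Maps.

Section Product.
Variables (I : Type) (V : I -> lmodType R).

Definition prodm := forall i, V i.

HB.instance Definition _ := Choice.on prodm.

Implicit Types x y z : prodm.
Definition prodm_add x y : prodm := fun i => x i + y i.
Definition prodm_opp x : prodm := fun i => - x i.
Definition prodm_scale (a : R) x : prodm := fun i => a *: x i.

Lemma prodm_ext x y : (forall i, x i = y i) -> x = y.
Proof. exact: functional_extensionality_dep. Qed.

Fact prodm_addA : associative prodm_add.
Proof. by move=> x y z; apply: prodm_ext => i; apply: addrA. Qed.
Fact prodm_addC : commutative prodm_add.
Proof. by move=> x y; apply: prodm_ext => i; apply: addrC. Qed.
Fact prodm_add0 : left_id (fun=> 0) prodm_add.
Proof. by move=> x; apply: prodm_ext => i; apply: add0r. Qed.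
Fact prodm_addN : left_inverse (fun=> 0) prodm_opp prodm_add.
Proof. by move=> x; apply: prodm_ext => i; apply: addNr. Qed.
HB.instance Definition _ :=
  GRing.isZmodule.Build prodm prodm_addA prodm_addC prodm_add0 prodm_addN.

Fact prodm_scaleA a b x :
  prodm_scale a (prodm_scale b x) = prodm_scale (a * b) x.
Proof. by apply: prodm_ext => i; apply: scalerA. Qed.
Fact prodm_scale1 : left_id 1 prodm_scale.
Proof. by move=> x; apply: prodm_ext => i; apply: scale1r. Qed.
Fact prodm_scaleDr : right_distributive prodm_scale +%R.
Proof. by move=> a x y; apply: prodm_ext => i; apply: scalerDr. Qed.
Fact prodm_scaleDl x : {morph prodm_scale^~ x : a b / a + b}.
Proof. by move=> a b; apply: prodm_ext => i; apply: scalerDl. Qed.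
HB.instance Definition _ := GRing.Zmodule_isLmodule.Build R prodm
  prodm_scaleA prodm_scale1 prodm_scaleDr prodm_scaleDl.

Lemma prodm0E i : (0 : prodm) i = 0.
Proof. by []. Qed.

Lemma prodmPE a x y i : (a *: x + y) i = a *: x i + y i.
Proof. by []. Qed.

End Product.

Section ProductMap.
Variables (I : Type) (V W : I -> lmodType R) (f : forall i, {linear V i -> W i}).

Definition pmap_fun (x : prodm V) : prodm W := fun i => f i (x i).

Lemma pmap_linear : linear pmap_fun.
Proof. by move=> a x y; apply: prodm_ext => i; apply: linearP. Qed.
HB.instance Definition _ :=
  GRing.isLinear.Build R (prodm V) (prodm W) _ pmap_fun pmap_linear.

Definition pmap : {linear prodm V -> prodm W} := pmap_fun.

End ProductMap.

Section Cast.
Variables (V : int -> lmodType R) (m n : int) (e : m = n).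

Definition cast_fun (x : V m) : V n := ecast i (V i) e x.

Lemma cast_linear : linear cast_fun.
Proof. by rewrite /cast_fun; case: n / e. Qed.
HB.instance Definition _ :=
  GRing.isLinear.Build R (V m) (V n) _ cast_fun cast_linear.

Definition cast : {linear V m -> V n} := cast_fun.

End Cast.

Lemma cast_id (V : int -> lmodType R) m (e : m = m) (x : V m) : cast V e x = x.
Proof. by rewrite (Prop_irrelevance e erefl). Qed.

(* (-1)^n for an integer n, possibly negative. *)
Definition sgn (n : int) : R := (-1) ^+ `|n|%N.

Lemma sgnS n : sgn (n + 1) = - sgn n.
Proof.
case: n => [n|[|n]]; rewrite /sgn.
- by rewrite -[Posz n + 1]/(Posz (n + 1)%N) addn1 /= exprS mulN1r.
- by rewrite expr0 expr1 opprK.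
- have -> : Negz n.+1 + 1 = Negz n by rewrite !NegzE; lia.
  by rewrite /= exprS mulN1r exprS mulN1r exprS mulN1r !opprK.
Qed.

End Modules.

Arguments cast {R} V {m n} e : simpl never.
Arguments submod_of : simpl never.

Section Filtered.
Variable R : comPzRingType.

(* Chain complexes are graded cohomologically; [fc_F p n] is F_p A^n. *)
Record fcomplex := FComplex {
  fc_ob :> int -> lmodType R;
  fc_d : forall n, {linear fc_ob n -> fc_ob (n + 1)};
  fc_F : forall p n : int, submodClosed (fc_ob n);
  fc_dd : forall n (x : fc_ob n), fc_d _ (fc_d _ x) = 0;
  fc_Fd : forall p n x, x \in fc_F p n -> fc_d n x \in fc_F p (n + 1);
  fc_FS : forall p n x, x \in fc_F p n -> x \in fc_F (p + 1) n
}.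

Arguments fc_d {_} n.
Arguments fc_F _ : clear implicits.

Record fhom (A B : fcomplex) := FHom {
  fh_map :> forall n, {linear A n -> B n};
  fh_d : forall n (x : A n), fh_map (n + 1) (fc_d n x) = fc_d n (fh_map n x);
  fh_F : forall p n (x : A n), x \in fc_F A p n -> fh_map n x \in fc_F B p n
}.

Lemma fhom_ext A B (f g : fhom A B) : (forall n, f n =1 g n) -> f = g.
Proof.
case: f g => f fd fF [g gd gF] /= fg.
have {}fg : f = g.
  by apply: functional_extensionality_dep => n; apply/linear_ext/fg.
by subst g; congr FHom; apply: Prop_irrelevance.
Qed.

Program Definition fhom_id A : fhom A A := @FHom A A (fun n => idfun) _ _.
Next Obligation. by []. Qed.
Next Obligation. by []. Qed.

Program Definition fhom_comp A B C (g : fhom B C) (f : fhom A B) : fhom A C :=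
  @FHom A C (fun n => g n \o f n) _ _.
Next Obligation. by move=> A B C g f n x /=; rewrite !fh_d. Qed.
Next Obligation. by move=> A B C g f p n x Fx /=; do 2![apply: fh_F]. Qed.

Program Definition fC : category :=
  @Category fcomplex fhom fhom_id fhom_comp _ _ _.
Next Obligation. by move=> A B f; apply: fhom_ext. Qed.
Next Obligation. by move=> A B f; apply: fhom_ext. Qed.
Next Obligation. by move=> A B C D h g f; apply: fhom_ext. Qed.

Definition zero_mod : lmodType R :=
  prodm (fun x : void => match x return lmodType R with end).

Lemma zero_modP (x : zero_mod) : x = 0.
Proof. by apply: prodm_ext; case. Qed.

Program Definition fC_zero : fcomplex :=
  @FComplex (fun=> zero_mod) (fun=> idfun)
    (fun p n => submod_of (P := fun=> True) (conj I (fun _ _ _ _ _ => I)))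
    _ _ _.
Next Obligation. by move=> n x; apply: zero_modP. Qed.
Next Obligation. by move=> *; apply/submod_ofP. Qed.
Next Obligation. by move=> *; apply/submod_ofP. Qed.

Program Definition fC_from0 (A : fcomplex) : fhom fC_zero A :=
  @FHom fC_zero A (fun n => \0) _ _.
Next Obligation. by move=> A n x /=; rewrite linear0. Qed.
Next Obligation. by move=> A p n x _ /=; apply: rpred0. Qed.

Program Definition fC_to0 (A : fcomplex) : fhom A fC_zero :=
  @FHom A fC_zero (fun n => \0) _ _.
Next Obligation. by []. Qed.
Next Obligation. by move=> A p n x _ /=; apply: rpred0. Qed.

Lemma fC_initial : initial (fC_zero : fC).
Proof.
move=> A; exists (fC_from0 A); split=> // f _; apply: fhom_ext => n x.
by rewrite (zero_modP x) !linear0.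
Qed.

Lemma fC_terminal : terminal (fC_zero : fC).
Proof.
move=> A; exists (fC_to0 A); split=> // f _; apply: fhom_ext => n x.
by rewrite [RHS]zero_modP; apply: zero_modP.
Qed.

(* The differential into a degree only propositionally equal to m + 1. *)
Definition dsh (A : fcomplex) m n (e : m + 1 = n) : {linear A m -> A n} :=
  cast A e \o fc_d m.

Arguments dsh : simpl never.

Lemma fh_dsh A B (f : fhom A B) m n (e : m + 1 = n) x :
  f n (dsh A e x) = dsh B e (f m x).
Proof. by rewrite /dsh /=; case: n / e; rewrite !cast_id fh_d. Qed.

Lemma fh_cast A B (f : fhom A B) m n (e : m = n) x :
  f n (cast A e x) = cast B e (f m x).
Proof. by case: n / e; rewrite !cast_id. Qed.

Lemma dsh_F A p m n (e : m + 1 = n) x :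
  x \in fc_F A p m -> dsh A e x \in fc_F A p n.
Proof. by rewrite /dsh /=; case: n / e; rewrite cast_id => /fc_Fd. Qed.

Lemma cast_F A p m n (e : m = n) x :
  x \in fc_F A p m -> cast A e x \in fc_F A p n.
Proof. by case: n / e; rewrite cast_id. Qed.

Lemma dshE (A : fcomplex) n (x : A n) : dsh A (erefl (n + 1)) x = fc_d n x.
Proof. by []. Qed.

Lemma dsh_dsh (A : fcomplex) l m n (e : l + 1 = m) (e' : m + 1 = n) (x : A l) :
  dsh A e' (dsh A e x) = 0.
Proof.
case: m / e e' => e'; case: n / e'.
by rewrite !dshE fc_dd.
Qed.

(* The superscript (p, p + n) of k-cycles, k-boundaries and pages is recorded
   by the pair of arguments [p n]. The cycles Z_k^{p,p+n} and the boundaries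
   B_k^{p,p+n} are both submodules of [A n]; [BF] is indexed so that
   B_{k+1}^{p,p+n} = d Z_k^{p+k,p+k+n-1} + Z_k^{p-1,p-1+n}. *)
Section Pages.
Variable A : fcomplex.

Lemma ZF_closed (k : nat) (p n : int) :
  let P (x : A n) :=
    x \in fc_F A p n /\ fc_d n x \in fc_F A (p - k%:Z) (n + 1) in
  P 0 /\ forall a u v, P u -> P v -> P (a *: u + v).
Proof.
split=> /=; first by rewrite linear0 !rpred0.
move=> a u v [Fu Fdu] [Fv Fdv]; rewrite linearP.
by split; apply: rpredD => //; apply: rpredZ.
Qed.

Definition ZF k p n : submodClosed (A n) := submod_of (ZF_closed k p n).

Lemma ZFP k p n (x : A n) :
  reflect (x \in fc_F A p n /\ fc_d n x \in fc_F A (p - k%:Z) (n + 1))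
          (x \in ZF k p n).
Proof. exact: submod_ofP. Qed.

Lemma BF_closed (k : nat) (p n : int) :
  let P (x : A n) :=
    exists z w, [/\ z \in ZF k (p + k%:Z) (n - 1), w \in ZF k (p - 1) n
                  & x = dsh A (subrK 1 n) z + w] in
  P 0 /\ forall a u v, P u -> P v -> P (a *: u + v).
Proof.
move=> P; rewrite {}/P; split.
  by exists 0, 0; rewrite !rpred0 linear0 addr0; split.
move=> a _ _ [z [w [Zz Zw ->]]] [z' [w' [Zz' Zw' ->]]].
exists (a *: z + z'), (a *: w + w'); split.
- by apply: rpredD => //; apply: rpredZ.
- by apply: rpredD => //; apply: rpredZ.
- by rewrite linearP scalerDr addrACA.
Qed.

Definition BF k p n : submodClosed (A n) :=
  if k is k'.+1 then submod_of (BF_closed k' p n) else fc_F A (p - 1) n.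

Lemma BF0 p n : BF 0 p n = fc_F A (p - 1) n.
Proof. by []. Qed.

Lemma BFP k p n (x : A n) :
  reflect (exists z w, [/\ z \in ZF k (p + k%:Z) (n - 1), w \in ZF k (p - 1) n
                         & x = dsh A (subrK 1 n) z + w])
          (x \in BF k.+1 p n).
Proof. exact: submod_ofP. Qed.

Lemma BF_ZF k p n x : x \in BF k p n -> x \in ZF k p n.
Proof.
have FS q m (y : A m) : y \in fc_F A (q - 1) m -> y \in fc_F A q m.
  by rewrite -[in X in _ -> X](subrK 1 q); apply: fc_FS.
case: k => [|k].
  rewrite BF0 => Fx; apply/ZFP; rewrite subr0.
  by split; [|apply: fc_Fd]; apply: FS.
move=> /BFP[z [w [/ZFP[Fz Fdz] /ZFP[Fw Fdw] ->]]]; apply/ZFP.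
rewrite linearD -dshE dsh_dsh add0r; split.
  apply: rpredD; last exact: FS.
  by move: Fdz; rewrite -[p + k%:Z - k%:Z]addrA subrr addr0; apply: cast_F.
by have -> : p - k.+1%:Z = p - 1 - k%:Z by lia.
Qed.

(* By [BF_ZF], [BZ k p n] is B_k inside Z_k, so the quotient is Z_k / B_k. *)
Lemma BZ_closed k p n :
  let P (x : subm (ZF k p n)) := subm_val x \in BF k p n in
  P 0 /\ forall a u v, P u -> P v -> P (a *: u + v).
Proof.
split=> /=; first exact: rpred0.
by move=> a u v Bu Bv; apply: rpredD => //; apply: rpredZ.
Qed.

Definition BZ k p n : submodClosed (subm (ZF k p n)) :=
  submod_of (BZ_closed k p n).

Definition page k p n : lmodType R := quom (BZ k p n).

End Pages.

Section PageMap.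
Variables (A B : fcomplex) (f : fhom A B).

Lemma fh_ZF k p n x : x \in ZF A k p n -> f n x \in ZF B k p n.
Proof.
by move=> /ZFP[Fx Fdx]; apply/ZFP; rewrite -fh_d; split; apply: fh_F.
Qed.

Lemma fh_BF k p n x : x \in BF A k p n -> f n x \in BF B k p n.
Proof.
case: k => [|k]; first exact: fh_F.
move=> /BFP[z [w [Zz Zw ->]]]; apply/BFP; exists (f _ z), (f _ w).
by rewrite linearD fh_dsh; split=> //; apply: fh_ZF.
Qed.

Definition ZF_map k p n : {linear subm (ZF A k p n) -> subm (ZF B k p n)} :=
  smap (@fh_ZF k p n).

Lemma ZF_map_BZ k p n x : x \in BZ A k p n -> ZF_map k p n x \in BZ B k p n.
Proof. by move=> /submod_ofP Bx; apply/submod_ofP/fh_BF. Qed.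

Definition page_map k p n : {linear page A k p n -> page B k p n} :=
  qmap (@ZF_map_BZ k p n).

Definition r_weq (r : nat) := forall p n, bijective (page_map r.+1 p n).

End PageMap.

End Filtered.

Arguments fc_d {R _} n.
Arguments fc_F {R} _ p n.

Section Bicomplexes.
Variable R : comPzRingType.

(* A bicomplex is indexed by its first degree and its total degree: [X i n]
   is the component of bidegree (i, i + n), so that the vertical differential
   (i, j) -> (i, j + 1) goes from [X i n] to [X i (n + 1)], and the horizontal
   differential (i + 1, j) -> (i, j) goes from [X (i + 1) n] to
   [X i (n + 1)]. *)
Record bicomplex := Bicomplex {
  bc_ob :> int -> int -> lmodType R;
  bc_d0 : forall i n, {linear bc_ob i n -> bc_ob i (n + 1)};
  bc_d1 : forall i n, {linear bc_ob (i + 1) n -> bc_ob i (n + 1)};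
  bc_d0d0 : forall i n (x : bc_ob i n), bc_d0 _ _ (bc_d0 _ _ x) = 0;
  bc_d1d1 : forall i n (x : bc_ob (i + 1 + 1) n),
    bc_d1 i _ (bc_d1 _ _ x) = 0;
  bc_d0d1 : forall i n (x : bc_ob (i + 1) n),
    bc_d0 _ _ (bc_d1 i _ x) = bc_d1 i _ (bc_d0 _ _ x)
}.

Arguments bc_d0 {_} i n.
Arguments bc_d1 {_} i n.

Record bhom (X Y : bicomplex) := BHom {
  bh_map :> forall i n, {linear X i n -> Y i n};
  bh_d0 : forall i n (x : X i n),
    bh_map _ _ (bc_d0 i n x) = bc_d0 i n (bh_map _ _ x);
  bh_d1 : forall i n (x : X (i + 1) n),
    bh_map _ _ (bc_d1 i n x) = bc_d1 i n (bh_map _ _ x)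
}.

Lemma bhom_ext X Y (f g : bhom X Y) : (forall i n, f i n =1 g i n) -> f = g.
Proof.
case: f g => f f0 f1 [g g0 g1] /= fg.
have {}fg : f = g.
  apply: functional_extensionality_dep => i.
  by apply: functional_extensionality_dep => n; apply/linear_ext/fg.
by subst g; congr BHom; apply: Prop_irrelevance.
Qed.

Program Definition bhom_id X : bhom X X := @BHom X X (fun i n => idfun) _ _.
Next Obligation. by []. Qed.
Next Obligation. by []. Qed.

Program Definition bhom_comp X Y Z (g : bhom Y Z) (f : bhom X Y) : bhom X Z :=
  @BHom X Z (fun i n => g i n \o f i n) _ _.
Next Obligation. by move=> X Y Z g f i n x /=; rewrite !bh_d0. Qed.
Next Obligation. by move=> X Y Z g f i n x /=; rewrite !bh_d1. Qed.

Program Definition bC : category :=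
  @Category bicomplex bhom bhom_id bhom_comp _ _ _.
Next Obligation. by move=> X Y f; apply: bhom_ext. Qed.
Next Obligation. by move=> X Y f; apply: bhom_ext. Qed.
Next Obligation. by move=> X Y Z W h g f; apply: bhom_ext. Qed.

Program Definition bC_zero : bicomplex :=
  @Bicomplex (fun _ _ => zero_mod R) (fun _ _ => idfun) (fun _ _ => idfun)
    _ _ _.
Next Obligation. by move=> i n x; apply: zero_modP. Qed.
Next Obligation. by move=> i n x; apply: zero_modP. Qed.
Next Obligation. by []. Qed.

Program Definition bC_from0 (X : bicomplex) : bhom bC_zero X :=
  @BHom bC_zero X (fun i n => \0) _ _.
Next Obligation. by move=> X i n x /=; rewrite linear0. Qed.
Next Obligation. by move=> X i n x /=; rewrite linear0. Qed.

Program Definition bC_to0 (X : bicomplex) : bhom X bC_zero :=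
  @BHom X bC_zero (fun i n => \0) _ _.
Next Obligation. by []. Qed.
Next Obligation. by []. Qed.

Lemma bC_initial : initial (bC_zero : bC).
Proof.
move=> X; exists (bC_from0 X); split=> // f _; apply: bhom_ext => i n x.
by rewrite (zero_modP x) !linear0.
Qed.

Lemma bC_terminal : terminal (bC_zero : bC).
Proof.
move=> X; exists (bC_to0 X); split=> // f _; apply: bhom_ext => i n x.
by rewrite [RHS]zero_modP; apply: zero_modP.
Qed.

Definition d1sh (X : bicomplex) i i' n (e : i = i' + 1) :
    {linear X i n -> X i' (n + 1)} :=
  bc_d1 i' n \o cast (X ^~ n) e.

Arguments d1sh : simpl never.

Lemma bh_d1sh X Y (f : bhom X Y) i i' n (e : i = i' + 1) x :
  f _ _ (d1sh X n e x) = d1sh Y n e (f _ _ x).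
Proof.
rewrite /d1sh /= bh_d1; congr (bc_d1 _ _ _).
by move: (i' + 1) e => j; case: j /; rewrite !cast_id.
Qed.

Lemma succ_index k (j j' : 'I_k) (p : int) :
  j' = j.+1 :> nat -> p - j%:Z = p - j'%:Z + 1.
Proof. by lia. Qed.

(* The tuple (a_0, .., a_k) of a (k+1)-witness cycle; a_j has bidegree
   (p - j, p + n - j), hence total degree n. *)
Definition ZW_cond (X : bicomplex) (k : nat) (p n : int)
    (a : prodm (fun j : 'I_k.+1 => X (p - j%:Z) n)) : Prop :=
  bc_d0 _ _ (a ord0) = 0 /\
  forall (j j' : 'I_k.+1) (e : j' = j.+1 :> nat),
    bc_d0 _ _ (a j') = d1sh X n (succ_index p e) (a j).

Lemma ZW_closed (X : bicomplex) (k : nat) (p n : int) :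
  ZW_cond (0 : prodm (fun j : 'I_k.+1 => X (p - j%:Z) n)) /\
  forall a u v, ZW_cond u -> ZW_cond v ->
    ZW_cond (a *: u + v : prodm (fun j : 'I_k.+1 => X (p - j%:Z) n)).
Proof.
split; first by split=> [|j j' e]; rewrite !prodm0E !linear0.
move=> a u v [u0 uS] [v0 vS]; split=> [|j j' e]; rewrite !prodmPE !linearP.
  by rewrite u0 v0 scaler0; apply: addr0.
by rewrite (uS j j' e) (vS j j' e).
Qed.

Definition ZW (X : bicomplex) (k : nat) (p n : int) : lmodType R :=
  if k is k'.+1 then subm (submod_of (ZW_closed X k' p n)) else X p n.

Lemma ZW_map_subproof (X Y : bicomplex) (f : bhom X Y) (k : nat) (p n : int)
    (a : prodm (fun j : 'I_k.+1 => X (p - j%:Z) n)) :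
  a \in submod_of (ZW_closed X k p n) ->
  pmap (fun j : 'I_k.+1 => f (p - j%:Z) n) a
    \in submod_of (ZW_closed Y k p n).
Proof.
move=> /submod_ofP[a0 aS]; apply/submod_ofP; split=> [|j j' e].
  by rewrite /= /pmap_fun -bh_d0 a0 linear0.
by rewrite /= /pmap_fun -bh_d0 (aS j j' e) bh_d1sh.
Qed.

Definition ZW_map X Y (f : bhom X Y) k p n :
    {linear ZW X k p n -> ZW Y k p n} :=
  match k with
  | 0 => f p n
  | k'.+1 => smap (@ZW_map_subproof X Y f k' p n)
  end.

Section TotOb.
Variable X : bicomplex.

Definition Tot_ob (n : int) : lmodType R := prodm (fun i : int => X i n).

Definition Tot_d_fun n (a : Tot_ob n) : Tot_ob (n + 1) :=
  fun i => bc_d0 i n (a i) + sgn R n *: bc_d1 i n (a (i + 1)).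

Lemma Tot_d_linear n : linear (@Tot_d_fun n).
Proof.
move=> c a b; apply: prodm_ext => i; rewrite prodmPE /Tot_d_fun !prodmPE.
rewrite !linearP !scalerDr !scalerA [c * _]mulrC.
by rewrite addrACA.
Qed.
HB.instance Definition _ n :=
  GRing.isLinear.Build R (Tot_ob n) (Tot_ob (n + 1)) _
    (@Tot_d_fun n) (@Tot_d_linear n).

Definition Tot_d n : {linear Tot_ob n -> Tot_ob (n + 1)} := @Tot_d_fun n.

Lemma Tot_F_closed (p n : int) :
  let P (a : Tot_ob n) := forall i, p < i -> a i = 0 in
  P 0 /\ forall c u v, P u -> P v -> P (c *: u + v).
Proof.
split=> //= c u v Pu Pv i pi.
by rewrite -[LHS]/(c *: u i + v i) Pu // Pv // scaler0 addr0.
Qed.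

Definition Tot_F p n : submodClosed (Tot_ob n) := submod_of (Tot_F_closed p n).

Program Definition Tot_fc : fcomplex R :=
  @FComplex R Tot_ob Tot_d Tot_F _ _ _.
Next Obligation.
move=> n a; apply: prodm_ext => i; rewrite /= /Tot_d_fun.
rewrite !linearD !linearZ /= bc_d0d0 bc_d1d1 !scaler0 add0r bc_d0d1 sgnS.
by rewrite scaleNr addrA subrr; apply: addr0.
Qed.
Next Obligation.
move=> p n a /submod_ofP Fa; apply/submod_ofP => i pi.
by rewrite /= /Tot_d_fun !Fa ?linear0 ?scaler0 ?addr0 //; lia.
Qed.
Next Obligation.
by move=> p n a /submod_ofP Fa; apply/submod_ofP => i pi; apply: Fa; lia.
Qed.

End TotOb.

Program Definition Tot_hom X Y (f : bhom X Y) : fhom (Tot_fc X) (Tot_fc Y) :=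
  @FHom R (Tot_fc X) (Tot_fc Y) (fun n => pmap (fun i => f i n)) _ _.
Next Obligation.
move=> X Y f n a; apply: prodm_ext => i; rewrite /= /pmap_fun /Tot_d_fun.
by rewrite linearD linearZ bh_d0 bh_d1.
Qed.
Next Obligation.
move=> X Y f p n a /submod_ofP Fa; apply/submod_ofP => i pi.
by rewrite /= /pmap_fun Fa // linear0.
Qed.

Program Definition Tot : functor bC (fC R) :=
  @Functor bC (fC R) Tot_fc Tot_hom _ _.
Next Obligation. by move=> X; apply: fhom_ext. Qed.
Next Obligation. by move=> X Y Z g f; apply: fhom_ext. Qed.

Lemma deg_shift (n : int) : n = n + 1 - 1.
Proof. by lia. Qed.

Lemma deg_shift1 (n : int) : n - 1 + 1 = n + 1 - 1.
Proof. by lia. Qed.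

Lemma F_le (A : fcomplex R) (p q n : int) (x : A n) :
  p <= q -> x \in fc_F A p n -> x \in fc_F A q n.
Proof.
move=> pq Fx; have -> : q = p + `|q - p|%N%:Z by lia.
elim: `|q - p|%N => [|k IH]; first by rewrite addr0.
by rewrite -addn1 PoszD addrA; apply: fc_FS.
Qed.

Section LOb.
Variable A : fcomplex R.

Definition L_ob (i n : int) : lmodType R :=
  (quom (fc_F A (i - 1) n) * quom (fc_F A i (n - 1)))%type.

Lemma L_cast_F i q n (x : A n) : q <= i ->
  x \in fc_F A q n -> cast A (deg_shift n) x \in fc_F A i (n + 1 - 1).
Proof. by move=> qi Fx; apply: cast_F; apply: F_le Fx. Qed.

Lemma L_le0 (i : int) : i - 1 <= i. Proof. by lia. Qed.
Lemma L_le1 (i : int) : i + 1 - 1 <= i. Proof. by lia. Qed.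

Definition L_d0_fun i n (u : L_ob i n) : L_ob i (n + 1) :=
  (qmap (@fc_Fd R A (i - 1) n) u.1,
   qmap (fun x => @L_cast_F i (i - 1) n x (L_le0 i)) u.1
     - qmap (@dsh_F R A i _ _ (deg_shift1 n)) u.2).

Definition L_d1_fun i n (u : L_ob (i + 1) n) : L_ob i (n + 1) :=
  (0, sgn R (n + 1)
        *: qmap (fun x => @L_cast_F i (i + 1 - 1) n x (L_le1 i)) u.1).

Lemma L_d0_linear i n : linear (@L_d0_fun i n).
Proof.
move=> a u v; rewrite /L_d0_fun !linearP; congr pair.
by rewrite addrACA -scalerDr.
Qed.
HB.instance Definition _ i n :=
  GRing.isLinear.Build R (L_ob i n) (L_ob i (n + 1)) _
    (@L_d0_fun i n) (@L_d0_linear i n).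

Lemma L_d1_linear i n : linear (@L_d1_fun i n).
Proof.
move=> a u v; rewrite /L_d1_fun linearP; congr pair.
  by rewrite /= scaler0 addr0.
by rewrite /= scalerDr !scalerA mulrC.
Qed.
HB.instance Definition _ i n :=
  GRing.isLinear.Build R (L_ob (i + 1) n) (L_ob i (n + 1)) _
    (@L_d1_fun i n) (@L_d1_linear i n).

Definition L_d0 i n : {linear L_ob i n -> L_ob i (n + 1)} := @L_d0_fun i n.
Definition L_d1 i n : {linear L_ob (i + 1) n -> L_ob i (n + 1)} :=
  @L_d1_fun i n.

Definition Lq i n (x : A n) (y : A (n - 1)) : L_ob i n := (qpi _ x, qpi _ y).

Lemma L_obP i n (u : L_ob i n) : exists x y, u = Lq i x y.
Proof.
by case: u => u v; exists (repr u), (repr v); rewrite /Lq !reprK_quom.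
Qed.

Lemma L_d0E i n x y : L_d0 i n (Lq i x y) =
  Lq i (fc_d n x) (cast A (deg_shift n) x - dsh A (deg_shift1 n) y).
Proof.
congr pair; first exact: qmapE.
by rewrite linearB; congr (_ - _); apply: qmapE.
Qed.

Lemma L_d1E i n x y : L_d1 i n (Lq (i + 1) x y) =
  Lq i 0 (sgn R (n + 1) *: cast A (deg_shift n) x).
Proof.
congr pair; first by rewrite linear0.
by rewrite linearZZ; congr (_ *: _); apply: qmapE.
Qed.

Lemma fc_d_cast m n (e : m = n) (x : A m) :
  fc_d n (cast A e x) = cast A (congr1 (+%R^~ 1) e) (fc_d m x).
Proof. by case: n / e; rewrite !cast_id. Qed.

Lemma cast_cast (V : int -> lmodType R) l m n (e : l = m) (e' : m = n) x :
  cast V e' (cast V e x) = cast V (etrans e e') x.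
Proof. by case: n / e'; case: m / e; rewrite !cast_id. Qed.

Lemma dsh_cast l m n (e : l = m) (e' : m + 1 = n) (e'' : l + 1 = n) x :
  dsh A e' (cast A e x) = dsh A e'' x.
Proof.
by case: m / e e' => e'; rewrite cast_id (Prop_irrelevance e' e'').
Qed.

Lemma cast_dsh l m n (e : l + 1 = m) (e' : m = n) (e'' : l + 1 = n) x :
  cast A e' (dsh A e x) = dsh A e'' x.
Proof.
by case: n / e' e'' => e''; rewrite cast_id (Prop_irrelevance e e'').
Qed.

Program Definition L_bc : bicomplex := @Bicomplex L_ob L_d0 L_d1 _ _ _.
Next Obligation.
move=> i n u; have [x [y ->]] := L_obP u; rewrite !L_d0E fc_dd linearB.
rewrite dsh_dsh subr0 -dshE.
rewrite (dsh_cast _ _ (deg_shift (n + 1))).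
rewrite (cast_dsh _ _ (deg_shift (n + 1))) subrr.
by rewrite /Lq !linear0.
Qed.
Next Obligation.
move=> i n u; have [x [y ->]] := L_obP u; rewrite !L_d1E.
by rewrite !linear0 /Lq !linear0.
Qed.
Next Obligation.
move=> i n u; have [x [y ->]] := L_obP u; rewrite L_d0E !L_d1E L_d0E.
rewrite !linear0 sub0r; congr Lq; rewrite linearZZ [sgn R (n + 1 + 1)]sgnS scaleNr.
congr (- (_ *: _)); rewrite -dshE.
rewrite (dsh_cast _ _ (deg_shift (n + 1))).
by rewrite (cast_dsh _ _ (deg_shift (n + 1))).
Qed.

End LOb.

Section LHom.
Variables (A B : fcomplex R) (f : fhom A B).

Definition L_map_fun i n (u : L_ob A i n) : L_ob B i n :=
  (qmap (@fh_F R A B f (i - 1) n) u.1, qmap (@fh_F R A B f i (n - 1)) u.2).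

Lemma L_map_linear i n : linear (@L_map_fun i n).
Proof. by move=> a u v; rewrite /L_map_fun !linearP. Qed.
HB.instance Definition _ i n :=
  GRing.isLinear.Build R (L_ob A i n) (L_ob B i n) _
    (@L_map_fun i n) (@L_map_linear i n).

Definition L_map i n : {linear L_ob A i n -> L_ob B i n} := @L_map_fun i n.

Lemma L_mapE i n x y :
  L_map i n (Lq i x y) = Lq i (f n x) (f (n - 1) y).
Proof. by congr pair; apply: qmapE. Qed.

Program Definition L_hom : bhom (L_bc A) (L_bc B) := @BHom _ _ L_map _ _.
Next Obligation.
move=> i n u; have [x [y ->]] := L_obP u.
rewrite [L_map _ _ _](congr1 _ (L_d0E i x y)) L_mapE.
rewrite [RHS](congr1 _ (L_mapE i x y)) [RHS]L_d0E.
by rewrite fh_d linearB fh_cast fh_dsh.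
Qed.
Next Obligation.
move=> i n u; have [x [y ->]] := L_obP u.
rewrite [L_map _ _ _](congr1 _ (L_d1E i x y)) L_mapE.
rewrite [RHS](congr1 _ (L_mapE (i + 1) x y)) [RHS]L_d1E.
by rewrite linear0 linearZZ fh_cast.
Qed.

End LHom.

Program Definition L : functor (fC R) bC := @Functor (fC R) bC L_bc L_hom _ _.
Next Obligation.
move=> A; apply: bhom_ext => i n u; have [x [y ->]] := L_obP u.
exact: L_mapE.
Qed.
Next Obligation.
move=> A B C g f; apply: bhom_ext => i n u; have [x [y ->]] := L_obP u.
rewrite [LHS]L_mapE [RHS](congr1 _ (L_mapE f i x y)).
by rewrite [RHS]L_mapE.
Qed.

Section Adj.
Variables (A : fcomplex R) (Y : bicomplex).

Definition L_inl i n : A n -> L_ob A i n := fun x => Lq i x 0.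

Lemma L_inl_linear i n : linear (@L_inl i n).
Proof.
move=> a x y; rewrite /L_inl /Lq linearP; congr pair.
by rewrite /= linear0 scaler0 addr0.
Qed.
HB.instance Definition _ i n :=
  GRing.isLinear.Build R (A n) (L_ob A i n) _ (@L_inl i n) (@L_inl_linear i n).

Section Transpose.
Variable f : bhom (L_bc A) Y.

Definition Tr_fun n (x : A n) : Tot_fc Y n := fun i => f i n (L_inl i x).

Lemma Tr_linear n : linear (@Tr_fun n).
Proof.
move=> a x y; apply: prodm_ext => i; rewrite prodmPE /Tr_fun.
by rewrite !linearP.
Qed.
HB.instance Definition _ n :=
  GRing.isLinear.Build R (A n) (Tot_fc Y n) _ (@Tr_fun n) (@Tr_linear n).

Program Definition Tr : fhom A (Tot_fc Y) := @FHom R A (Tot_fc Y) Tr_fun _ _.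
Next Obligation.
move=> n x; apply: prodm_ext => i.
rewrite -[RHS]/(bc_d0 i n (f i n (L_inl i x))
                + sgn R n *: bc_d1 i n (f _ n (L_inl (i + 1) x))).
rewrite -bh_d0 -bh_d1 -linearZZ -linearD.
rewrite -[LHS]/(f i (n + 1) (L_inl i (fc_d n x))); congr (f _ _ _).
rewrite [X in _ = X + _]L_d0E [X in _ = _ + _ *: X]L_d1E.
rewrite linear0 subr0 -[RHS]/(_ + _, _ + _) /=.
rewrite linear0 scaler0 addr0; congr pair.
rewrite linear0 linearZZ sgnS scaleNr scalerN scalerA.
by rewrite /sgn -exprD addnn -mul2n exprM sqrrN expr1n expr1n scale1r subrr.
Qed.
Next Obligation.
move=> p n x Fx; apply/submod_ofP => i pi.
rewrite -[LHS]/(f i n (L_inl i x)) -(linear0 (f i n)); congr (f _ _ _).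
rewrite /L_inl /Lq linear0; congr pair.
have -> : 0 = qpi (fc_F A (i - 1) n) 0 by rewrite linear0.
by apply/qpiP; rewrite subr0; apply: F_le Fx; lia.
Qed.

End Transpose.

Section Untranspose.
Variable g : fhom A (Tot_fc Y).

Definition pr_fun i n (x : A n) : Y i n := g n x i.

Lemma pr_linear i n : linear (@pr_fun i n).
Proof. by move=> a x y; rewrite /pr_fun linearP. Qed.
HB.instance Definition _ i n :=
  GRing.isLinear.Build R (A n) (Y i n) _ (@pr_fun i n) (@pr_linear i n).

Definition pr i n : {linear A n -> Y i n} := @pr_fun i n.

Lemma pr_F i p n x : p < i -> x \in fc_F A p n -> pr i n x = 0.
Proof. by move=> pi /(@fh_F _ _ _ g)/submod_ofP; apply. Qed.

Lemma pr_d i n x :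
  pr i (n + 1) (fc_d n x) =
    bc_d0 i n (pr i n x) + sgn R n *: bc_d1 i n (pr (i + 1) n x).
Proof. by rewrite /= /pr_fun fh_d. Qed.

Definition D1 i m n (e : m + 1 = n) : {linear Y (i + 1) m -> Y i n} :=
  cast (Y i) e \o bc_d1 i m.

Lemma lt0 (i : int) : i - 1 < i. Proof. by lia. Qed.
Lemma lt1 (i : int) : i < i + 1. Proof. by lia. Qed.

Definition Un_fun i n (u : L_ob A i n) : Y i n :=
  qlift (fun x => @pr_F i (i - 1) n x (lt0 i)) u.1
  + sgn R n *: D1 i (subrK 1 n)
      (qlift (fun x => @pr_F (i + 1) i (n - 1) x (lt1 i)) u.2).

Lemma Un_linear i n : linear (@Un_fun i n).
Proof.
move=> a u v; rewrite /Un_fun !linearP !scalerDr.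
by rewrite addrACA.
Qed.
HB.instance Definition _ i n :=
  GRing.isLinear.Build R (L_ob A i n) (Y i n) _ (@Un_fun i n) (@Un_linear i n).

Definition Un_map i n : {linear L_ob A i n -> Y i n} := @Un_fun i n.

Lemma Un_mapE i n x y : Un_map i n (Lq i x y) =
  pr i n x + sgn R n *: D1 i (subrK 1 n) (pr (i + 1) (n - 1) y).
Proof.
congr (_ + _); first exact: qliftE.
by congr (_ *: D1 _ _ _); apply: qliftE.
Qed.

Lemma D1_pr_cast i m m' n (e : m = m') (e' : m' + 1 = n) (e'' : m + 1 = n) x :
  D1 i e' (pr (i + 1) m' (cast A e x)) = D1 i e'' (pr (i + 1) m x).
Proof.
by case: m' / e e' => e'; rewrite cast_id (Prop_irrelevance e' e'').
Qed.

Lemma D1E i m x : D1 i (erefl (m + 1)) x = bc_d1 i m x.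
Proof. by []. Qed.

Lemma pr_dsh i m n (e : m + 1 = n) x :
  pr i n (dsh A e x) =
    cast (Y i) e (bc_d0 i m (pr i m x)) + sgn R m *: D1 i e (pr (i + 1) m x).
Proof. by case: n / e; rewrite dshE pr_d cast_id D1E. Qed.

Lemma D1_cast i m m' n (e : m = m') (e' : m' + 1 = n) (e'' : m + 1 = n) x :
  D1 i e' (cast (Y (i + 1)) e x) = D1 i e'' x.
Proof.
by case: m' / e e' => e'; rewrite cast_id (Prop_irrelevance e' e'').
Qed.

Lemma d1_D1 i m n (e : m + 1 = n) x : bc_d1 i n (D1 (i + 1) e x) = 0.
Proof. by case: n / e; rewrite D1E bc_d1d1. Qed.

Lemma D1_D1 i l m n (e : l + 1 = m) (e' : m + 1 = n) x :
  D1 i e' (D1 (i + 1) e x) = 0.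
Proof. by case: n / e'; apply: d1_D1. Qed.

Lemma d0_D1 i l m n (e : l + 1 = m) (e' : l + 1 = n) (e'' : n + 1 = m + 1) x :
  bc_d0 i m (D1 i e x) = D1 i e'' (cast (Y (i + 1)) e' (bc_d0 _ _ x)).
Proof.
case: m / e e''; case: n / e' => e''.
by rewrite cast_id D1E bc_d0d1 (Prop_irrelevance e'' erefl) D1E.
Qed.

Lemma sgnK n : sgn R n * sgn R n = 1.
Proof. by rewrite /sgn -exprD addnn -mul2n exprM sqrrN expr1n expr1n. Qed.

Program Definition Un : bhom (L_bc A) Y := @BHom (L_bc A) Y Un_map _ _.
Next Obligation.
move=> i n u; have [x [y ->]] := L_obP u.
rewrite [LHS](congr1 _ (L_d0E i x y)) Un_mapE.
rewrite [RHS](congr1 _ (Un_mapE i x y)) pr_d.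
rewrite (linearB (pr (i + 1) (n + 1 - 1))) (linearB (D1 _ _)) (linearD (bc_d0 _ _)).
rewrite (linearZZ (bc_d0 _ _)).
rewrite (D1_pr_cast _ _ _ (erefl (n + 1))) D1E.
rewrite sgnS scaleNr scalerBr opprB addrA addrAC addrK.
rewrite pr_dsh linearD linearZZ D1_D1 scaler0 addr0.
congr (_ + _ *: _).
by rewrite (d0_D1 _ (deg_shift1 n) (subrK 1 (n + 1))).
Qed.
Next Obligation.
move=> i n u; have [x [y ->]] := L_obP u.
rewrite [LHS](congr1 _ (L_d1E i x y)) Un_mapE.
rewrite [RHS](congr1 _ (Un_mapE (i + 1) x y)).
rewrite linear0 add0r !linearZZ (D1_pr_cast _ _ _ (erefl (n + 1))) D1E.
rewrite linearD linearZZ d1_D1 scaler0 addr0.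
by rewrite scalerA sgnK scale1r.
Qed.

End Untranspose.

Lemma D1_inl (f : bhom (L_bc A) Y) i m n
    (e : m + 1 = n) (e' : m = n - 1) (y : A m) :
  D1 i e (f _ _ (L_inl (i + 1) y)) =
    sgn R n *: f i n (Lq i 0 (cast A e' y)).
Proof.
case: n / e e' => e'; rewrite D1E -bh_d1 -linearZZ; congr (f _ _ _).
rewrite [LHS]L_d1E (Prop_irrelevance e' (deg_shift m)) /Lq.
by congr pair; rewrite ?linearZZ //= linear0 scaler0.
Qed.

Lemma TrK : cancel Tr Un.
Proof.
move=> f; apply: bhom_ext => i n u; have [x [y ->]] := L_obP u.
rewrite [LHS]Un_mapE [D1 _ _ _](D1_inl f i (subrK 1 n) erefl).
rewrite scalerA sgnK scale1r cast_id.
rewrite [pr _ _ _ _]/(f i n (L_inl i x)) -linearD; congr (f _ _ _).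
by rewrite /L_inl /Lq !linear0 /=; congr pair => /=; rewrite ?addr0 ?add0r.
Qed.

Lemma UnK : cancel Un Tr.
Proof.
move=> g; apply: fhom_ext => n x; apply: prodm_ext => i.
rewrite [LHS]Un_mapE linear0 linear0 scaler0.
exact: addr0.
Qed.

End Adj.

Program Definition L_Tot_adj : adjunction L Tot :=
  @Adjunction (fC R) bC L Tot Tr _ _ _.
Next Obligation. by move=> A Y; exists (@Un A Y); [exact: TrK | exact: UnK]. Qed.
Next Obligation.
move=> A A' Y f u; apply: fhom_ext => n x; apply: prodm_ext => i.
rewrite -[RHS]/(f i n (Lq i (u n x) 0)) -[LHS]/(f i n (L_map u i n (Lq i x 0))).
by rewrite L_mapE linear0.
Qed.
Next Obligation. by move=> A Y Y' f v; apply: fhom_ext. Qed.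

Definition b_weq (r : nat) (X Y : bicomplex) (f : bhom X Y) : Prop :=
  r_weq (Tot_hom f) r.

(* [S] is used with [ord_max \in S], so that r is the maximum of S. A model
   structure is determined by its weak equivalences and fibrations. *)
Definition fC_model (r : nat) (S : {set 'I_r.+1})
    (M : model_structure (fC R)) : Prop :=
  (forall (A B : fC R) (f : hom A B), weq M f <-> r_weq f r) /\
  (forall (A B : fC R) (f : hom A B), fib M f <->
     forall s : 'I_r.+1, s \in S ->
     forall (p n : int) y, exists x, ZF_map f s p n x = y).

Definition bC_model (r : nat) (S : {set 'I_r.+1})
    (M : model_structure bC) : Prop :=
  (forall (X Y : bC) (f : hom X Y), weq M f <-> b_weq r f) /\
  (forall (X Y : bC) (f : hom X Y), fib M f <->
     forall s : 'I_r.+1, s \in S ->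
     forall (p n : int) y, exists x, ZW_map f s p n x = y).

End Bicomplexes.

(* Main.v *)
Require Import Defs.
From mathcomp Require Import all_boot all_order all_algebra.
From mathcomp Require Import boolp zify.
Import Defs.

(** The unit [A -> Tot (L A)] of the adjunction is an [r]-weak equivalence for
every filtered complex [A] and every [r].  Indeed the column [i] of [L A] is,
up to a shift, the cone of the surjection [A/F_{i-1} -> A/F_i], so that the
map from the kernel [F_i/F_{i-1}] of this surjection is a quasi-isomorphism.
Since the vertical complexes of a bicomplex form the zeroth page of its
totalisation, this says that the unit induces an isomorphism on the first
pages ([unit_page1]).  An isomorphism of one page gives an isomorphism of the
next one, because each page is the cohomology of the previous one
([page_map_bijS]).

As the weak equivalences of bicomplexes are by definition detected by [Tot],
and as the transpose of [f : L A -> B] is the composite of [Tot f] with the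
unit, the two-out-of-three property then gives the equivalence
([quillen_equivalence_unit]).

It remains to see that the adjunction is a Quillen adjunction, that is, that
[Tot] preserves fibrations and acyclic fibrations
([quillen_adjunction_right]).  An [s]-cycle of [Tot X] in filtration [p] is a
family [(a_i)_{i <= p}] whose first [s] terms [a_p, .., a_{p-s+1}] satisfy, up
to signs, the equations of a witness cycle, while the other terms are
arbitrary; hence surjectivity on [ZW_s] and on [ZW_0] implies surjectivity on
[Z_s] ([Tot_ZF_map_surj]). *)

Set Implicit Arguments.
Unset Strict Implicit.
Unset Printing Implicit Defensive.

Import Order.TTheory GRing.Theory Num.Theory.
Local Open Scope ring_scope.

(** * Lifting properties and adjunctions *)

Lemma adjoint_lifting (C D : category) (F : functor C D) (G : functor D C)
    (a : adjunction F G) (A B : C) (X Y : D) (i : hom A B) (p : hom X Y) :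
  lifting i (fmor G p) -> lifting (fmor F i) p.
Proof.
move=> lift u v sq; have [g _ gK] := transpose_bij a B X.
have [|h [hi ph]] := lift (transpose a u) (transpose a v).
  by rewrite -transpose_natr -transpose_natl sq.
exists (g h); split.
  by apply: (bij_inj (transpose_bij a A X)); rewrite transpose_natl gK.
by apply: (bij_inj (transpose_bij a B Y)); rewrite transpose_natr gK.
Qed.

(** The retract argument: it allows a map to inherit the properties of the
first factor of a well-chosen factorisation. *)
Lemma retract_argument (C : category) (X Z Y : C) (i : hom X Z) (p : hom Z Y) :
  lifting (comp p i) p -> retract (comp p i) i.
Proof.
move=> lift; have [|h [hf ph]] := lift i (idm Y); first by rewrite comp1m.
exists (idm X), (idm X), h, p; split=> //; first by rewrite comp1m.
  by rewrite compm1 hf.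
by rewrite compm1.
Qed.

(** A map with the left lifting property against the (acyclic) fibrations is an
(acyclic) cofibration by the retract argument, and lifting problems for the
images of [F] are transposed to lifting problems against the images of [G]. *)
Lemma quillen_adjunction_right (C D : category) (M : model_structure C)
    (N : model_structure D) (F : functor C D) (G : functor D C)
    (a : adjunction F G) :
  (forall X Y (p : hom X Y), fib N p -> fib M (fmor G p)) ->
  (forall X Y (p : hom X Y), fib N p -> weq N p -> weq M (fmor G p)) ->
  quillen_adjunction M N a.
Proof.
move=> Gfib Gweq; split=> A B i ci => [|wi].
  have [Z [j [p [Fi cj fp wp]]]] := factor_acyclic_fib N (fmor F i).
  suff ret : retract (fmor F i) j by apply: cof_retract ret cj.
  rewrite {1}Fi; apply: retract_argument; rewrite -Fi.
  apply/(adjoint_lifting a)/(acyclic_fib_lifting ci); first exact: Gfib.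
  exact: Gweq.
have [Z [j [p [Fi cj wj fp]]]] := factor_acyclic_cof N (fmor F i).
suff ret : retract (fmor F i) j.
  by split; [apply: cof_retract ret cj | apply: weq_retract ret wj].
rewrite {1}Fi; apply: retract_argument; rewrite -Fi.
exact/(adjoint_lifting a)/(acyclic_cof_lifting ci wi)/Gfib.
Qed.

(** The transpose of [f : F X -> Y] is [G f] after the unit of [X]. *)
Lemma quillen_equivalence_unit (C D : category) (M : model_structure C)
    (N : model_structure D) (F : functor C D) (G : functor D C)
    (a : adjunction F G) :
  quillen_adjunction M N a ->
  (forall X Y (f : hom X Y), weq N f <-> weq M (fmor G f)) ->
  (forall X, weq M (transpose a (idm (F X)))) ->
  quillen_equivalence M N a.
Proof.
move=> qa Gweq unit; split=> // X Y _ _ f.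
have -> : transpose a f = comp (fmor G f) (transpose a (idm (F X))).
  by rewrite -transpose_natr compm1.
rewrite Gweq; split=> [wf|]; first exact: weq_comp.
exact: weq_cancelr.
Qed.

(** * Isomorphisms of pages persist *)

Section PersistentPages.
Variable R : comPzRingType.
Implicit Types A B : fcomplex R.

Lemma dsh_inF A p m n (e : m + 1 = n) (x : A m) :
  (dsh A e x \in fc_F A p n) = (fc_d m x \in fc_F A p (m + 1)).
Proof. by case: n / e. Qed.

Lemma fc_d_dsh A m n (e : m + 1 = n) (x : A m) : fc_d n (dsh A e x) = 0.
Proof. by rewrite -dshE dsh_dsh. Qed.

(** The two inequalities compare the filtration degree of the element and that
of its differential; they are the form in which all inclusions between cycles
are used below. *)
Lemma ZF_mono A k l (p q n : int) (x : A n) :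
  q <= p -> q - k%:Z <= p - l%:Z -> x \in ZF A k q n -> x \in ZF A l p n.
Proof.
move=> qp qkpl /ZFP[Fx Fdx]; apply/ZFP.
by split; [apply: F_le Fx | apply: F_le Fdx].
Qed.

Lemma dsh_ZF A k l (p q : int) m n (e : m + 1 = n) (x : A m) :
  q - k%:Z <= p -> x \in ZF A k q m -> dsh A e x \in ZF A l p n.
Proof.
move=> qkp /ZFP[_ Fdx]; apply/ZFP; rewrite fc_d_dsh rpred0; split=> //.
by rewrite dsh_inF; apply: F_le Fdx.
Qed.

(** [BF_intro] and [BF_elim] free the description of boundaries from the degree
[n - 1], which is only propositionally the predecessor of [n]. *)
Lemma BF_intro A k (p q : int) m n (e : m + 1 = n) (z : A m) (w : A n) :
  q = p + k%:Z -> z \in ZF A k q m -> w \in ZF A k (p - 1) n ->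
  dsh A e z + w \in BF A k.+1 p n.
Proof.
move=> -> Zz Zw; have em : m = n - 1 by lia.
apply/BFP; exists (cast A em z), w; split=> //.
  by case: _ / em.
by rewrite (dsh_cast _ _ e).
Qed.

Lemma BF_elim A k (p : int) m n (e : m + 1 = n) (x : A n) :
  x \in BF A k.+1 p n ->
  exists z w, [/\ z \in ZF A k (p + k%:Z) m, w \in ZF A k (p - 1) n
                & x = dsh A e z + w].
Proof.
move=> /BFP[z [w [Zz Zw ->]]]; have em : n - 1 = m by lia.
exists (cast A em z), w; split=> //; first by case: _ / em.
by rewrite (dsh_cast _ _ (subrK 1 n)).
Qed.

Section Map.
Variables (A B : fcomplex R) (f : fhom A B).

Lemma page_map_bijP k p n : bijective (page_map f k p n) <->
  (forall x, x \in ZF A k p n -> f n x \in BF B k p n -> x \in BF A k p n) /\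
  (forall y, y \in ZF B k p n ->
     exists2 x, x \in ZF A k p n & y - f n x \in BF B k p n).
Proof.
have page0 C (x : subm (ZF C k p n)) :
    (qpi (BZ C k p n) x == 0) = (subm_val x \in BF C k p n).
  rewrite -(linear0 (qpi (BZ C k p n))).
  apply/eqP/idP => [/qpiP|Bx]; first by rewrite subr0 => /submod_ofP.
  by apply/qpiP; rewrite subr0; apply/submod_ofP.
split=> [bij|[inj surj]].
  split=> [x Zx Bfx|y Zy].
    rewrite -[x]/(subm_val (Subm Zx)) -page0; apply/eqP/(bij_inj bij).
    by rewrite linear0 qmapE; apply/eqP; rewrite page0.
  have [g _ gK] := bij; have := gK (qpi _ (Subm Zy)).
  move: (g _) => q; rewrite -[q]reprK_quom qmapE => /eqP.
  rewrite eq_sym -subr_eq0 -linearB page0 /=.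
  by case: (repr q) => x Zx /= By; exists x.
have inj' : injective (page_map f k p n).
  move=> q q' /eqP; rewrite -[q]reprK_quom -[q']reprK_quom -subr_eq0 -!linearB.
  rewrite qmapE page0 => Bq; apply/eqP; rewrite -subr_eq0 -linearB page0.
  by apply: inj => //; apply: subm_valP.
have surj' q : exists q', page_map f k p n q' = q.
  rewrite -[q]reprK_quom; have [x Zx Bx] := surj _ (subm_valP (repr q)).
  exists (qpi _ (Subm Zx)); rewrite qmapE; apply/esym/eqP.
  by rewrite -subr_eq0 -linearB page0.
exists (fun q => projT1 (cid (surj' q))) => q; last by case: (cid _).
by apply: inj'; case: (cid _).
Qed.

(** An isomorphism [E_k] of pages, for [k > 0], induces one on [E_{k+1}].  This
is the chase in the cohomology of the [k]-page, carried out on elements of the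
complexes, so that neither the differential of the page nor the isomorphism
[E_{k+1} = H(E_k)] has to be constructed. *)
Lemma page_map_bijS k :
  (forall p n, bijective (page_map f k.+1 p n)) ->
  forall p n, bijective (page_map f k.+2 p n).
Proof.
move=> bij p n.
have inj q m := proj1 (proj1 (page_map_bijP k.+1 q m) (bij q m)).
have surj q m := proj2 (proj1 (page_map_bijP k.+1 q m) (bij q m)).
apply/page_map_bijP; split=> [x Zx /BFP[z [w [Zz Zw fxE]]]|y Zy].
  (* [f x] is the boundary of [z] modulo lower filtration; surjectivity of [f]
     on the page of [z] replaces [z] by the image of some [z']. *)
  have [z' Zz' /BFP[u [b [Zu Zb zE]]]] := surj _ _ _ Zz.
  have [||z1 [w1 [Zz1 Zw1 xE]]] :=
    BFP _ _ _ (inj p n (x - dsh A (subrK 1 n) z') _ _).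
  - apply: submod_sub; first by apply: ZF_mono Zx; clear; lia.
    by apply: dsh_ZF Zz'; clear; lia.
  - rewrite linearB fxE fh_dsh addrAC -linearB zE linearD dsh_dsh add0r.
    apply: BF_intro; [by [] | | by apply: ZF_mono Zw; clear; lia].
    by apply: ZF_mono Zb; clear; lia.
  have {}xE : x = dsh A (subrK 1 n) (z' + z1) + w1.
    by rewrite linearD -addrA -xE addrC subrK.
  have dw1 : fc_d n w1 = fc_d n x by rewrite xE linearD fc_d_dsh add0r.
  have [[_ Fdx] [Fw1 _]] := (ZFP _ _ _ Zx, ZFP _ _ _ Zw1).
  rewrite xE; apply: BF_intro => //.
    by apply: rpredD => //; apply: ZF_mono Zz1; clear; lia.
  by apply/ZFP; rewrite dw1; split=> //; apply: F_le Fdx; clear; lia.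
(* [y] is the image of some [x] on the lower page; as the page differential of
   [y] vanishes, so does that of [x], by injectivity, and [x] can be corrected
   by an element [u] of lower filtration to become a cycle of the next page. *)
have [|x Zx /BFP[z [w [Zz Zw yE]]]] := surj p n y.
  by apply: ZF_mono Zy; clear; lia.
have dyE : fc_d n (f n x) = fc_d n (- w) + fc_d n y.
  rewrite -[y](subrK (f n x)) yE !linearD fc_d_dsh add0r linearN.
  by rewrite addrA addNr add0r.
have Zdx : fc_d n x \in ZF A k.+1 (p - k.+1%:Z) (n + 1).
  by rewrite -dshE; apply: dsh_ZF Zx; clear; lia.
have Bdx : fc_d n x \in BF A k.+1 (p - k.+1%:Z) (n + 1).
  apply: inj => //; rewrite fh_d dyE -[fc_d n (- w)]dshE.
  apply: (@BF_intro _ _ _ (p - 1)); first by clear; lia.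
    exact: submod_opp Zw.
  by rewrite -dshE; apply: dsh_ZF Zy; clear; lia.
have [u [v [Zu Zv dxE]]] := BF_elim (erefl (n + 1)) Bdx.
have [[Fx _] [Fu _]] := (ZFP _ _ _ Zx, ZFP _ _ _ Zu).
have [[Fv _] [Fw _]] := (ZFP _ _ _ Zv, ZFP _ _ _ Zw).
have dxu : fc_d n (x - u) = v by rewrite linearB dxE dshE [_ + v]addrC addrK.
have Zxu : x - u \in ZF A k.+2 p n.
  apply/ZFP; rewrite dxu; split; last by apply: F_le Fv; clear; lia.
  by apply: submod_sub => //; apply: F_le Fu; clear; lia.
exists (x - u) => //.
have -> : y - f n (x - u) = dsh B (subrK 1 n) z + (w + f n u).
  by rewrite linearB opprB addrCA yE addrCA [f n u + w]addrC.
apply: BF_intro => //; first by apply: ZF_mono Zz; clear; lia.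
have {}yE : w + f n u = y - f n (x - u) - dsh B (subrK 1 n) z.
  rewrite linearB opprB [y + _]addrCA yE [dsh _ _ _ + w]addrC addrA addrK.
  exact: addrC.
apply/ZFP; split.
  by apply: rpredD => //; apply: fh_F; apply: F_le Fu; clear; lia.
rewrite yE linearB fc_d_dsh subr0 linearB -fh_d.
have [_ Fdy] := ZFP _ _ _ Zy.
apply: submod_sub; first by apply: F_le Fdy; clear; lia.
have [_ Fdxu] := ZFP _ _ _ (fh_ZF f Zxu).
by rewrite fh_d; apply: F_le Fdxu; clear; lia.
Qed.

End Map.
End PersistentPages.

(** * The unit of the adjunction *)

Section Unit.
Variable R : comPzRingType.
Implicit Types A : fcomplex R.

Lemma F_ZF0 A (p n : int) (x : A n) : x \in fc_F A p n -> x \in ZF A 0 p n.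
Proof. by move=> Fx; apply/ZFP; rewrite subr0; split=> //; apply: fc_Fd. Qed.

Lemma cast_inF A p m n (e : m = n) (x : A m) :
  (cast A e x \in fc_F A p n) = (x \in fc_F A p m).
Proof. by case: n / e; rewrite cast_id. Qed.

Lemma Tot_F_pred (X : bicomplex R) p n (a : Tot_fc X n) :
  a \in fc_F (Tot_fc X) p n -> a p = 0 -> a \in fc_F (Tot_fc X) (p - 1) n.
Proof.
move=> /submod_ofP Fa ap; apply/submod_ofP => i pi.
by have [/Fa //|pi'] := ltP p i; have -> : i = p by lia.
Qed.

Lemma Lq_eq A i n (x x' : A n) (y y' : A (n - 1)) :
  Lq i x y = Lq i x' y' <->
  x - x' \in fc_F A (i - 1) n /\ y - y' \in fc_F A i (n - 1).
Proof.
split=> [[ex ey]|[Fx Fy]]; first by split; apply/qpiP.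
by congr pair; apply/qpiP.
Qed.

Lemma Lq_sub A i n (x x' : A n) (y y' : A (n - 1)) :
  Lq i x y - Lq i x' y' = Lq i (x - x') (y - y').
Proof. by rewrite /Lq !linearB. Qed.

Lemma Lq0 A i n : 0 = Lq i (0 : A n) 0.
Proof. by rewrite /Lq !linear0. Qed.

(** Only the component [p] matters on the first page in filtration [p], the
higher ones being zero and the lower ones being killed.  There the relevant
facts are that [x - dy] lies in [F_p] when [d0 (x, y) = 0], and that
[(x, y) = (x - dy, 0) + d0 (y, 0)]. *)
Lemma unit_page1 A p n :
  bijective (page_map (Tr (bhom_id (L_bc A))) 1 p n).
Proof.
set T := Tot_fc (L_bc A); set eta := Tr _.
(* In a degree of the form [n + 1] the differential needs no transport. *)
have -> : n = n - 1 + 1 by lia.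
move: (n - 1) => {}n.
have Top m (a : T m) : a \in fc_F T p m -> a (p + 1) = 0.
  by move=> /submod_ofP; apply; lia.
apply/page_map_bijP; split=> [x Zx|y /ZFP[Fy Fdy]].
  move=> /(BF_elim (erefl _))[z [w [/ZFP[Fz _] /ZFP[Fw _] xE]]].
  have {Fw} wp : w p = 0 by move: Fw => /submod_ofP; apply; lia.
  rewrite addr0 in Fz.
  have : L_inl p x = L_d0 A p n (z p).
    rewrite -[LHS]/(eta _ x p) xE.
    rewrite -[LHS]/(L_d0 A p n (z p) + sgn R n *: L_d1 A p n (z (p + 1)) + w p).
    by rewrite wp (Top _ _ Fz) linear0 scaler0 !addr0.
  have [u [v ->]] := L_obP (z p); rewrite L_d0E => /Lq_eq[Fxu].
  rewrite sub0r -(cast_dsh (subrK 1 n) (deg_shift n)) -linearB => Fuv.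
  have {Fuv} := submod_opp Fuv; rewrite opprK cast_inF.
  set u' := u - _ => Fu'.
  have du' : fc_d n u' = fc_d n u by rewrite linearB fc_d_dsh subr0.
  rewrite -[x](subrK (fc_d n u)) -du' [_ + fc_d n u']addrC -dshE.
  apply: BF_intro; [by []|apply: F_ZF0|apply: F_ZF0]; first by rewrite addr0.
  by rewrite dshE du'.
have [u [v yp]] := L_obP (y p).
have [v' vE] : exists v', v = cast A (deg_shift n) v'.
  by exists (cast A (esym (deg_shift n)) v); rewrite cast_cast cast_id.
rewrite {}vE in yp.
have : L_d0 A p _ (y p) = 0.
  move: Fdy => /submod_ofP /(_ p) /= <-; last by lia.
  by rewrite /Tot_d_fun (Top _ _ Fy) linear0 scaler0 addr0.
rewrite yp L_d0E (Lq0 A) => /Lq_eq[]; rewrite !subr0 => Fdu.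
rewrite (dsh_cast _ _ (deg_shift (n + 1))).
rewrite -(cast_dsh (erefl _) (deg_shift (n + 1))).
rewrite -linearB cast_inF dshE.
set x := u - _ => Fx; exists x.
  by apply/ZFP; split=> //; rewrite linearB fc_dd subr0.
pose z : T n := fun i => if i == p then L_inl i v' else 0.
have Fz : z \in fc_F T p n.
  by apply/submod_ofP => i pi; rewrite /z ifF //; lia.
rewrite -[_ - _](subrK (fc_d n z)) [_ + fc_d n z]addrC -dshE.
apply: BF_intro; [by []|apply: F_ZF0|apply: F_ZF0]; first by rewrite addr0.
apply: Tot_F_pred.
  rewrite dshE; apply: submod_sub; last exact: fc_Fd.
  by apply: submod_sub => //; apply: fh_F.
rewrite -[LHS]/(y p - L_inl p x
   - (L_d0 A p n (z p) + sgn R n *: L_d1 A p n (z (p + 1)))).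
rewrite (Top _ _ Fz) linear0 scaler0 addr0 /z eqxx yp L_d0E linear0 subr0.
by rewrite !Lq_sub subr0 subrr opprB addrCA subrr addr0 subrr -Lq0.
Qed.

Lemma unit_r_weq A r : r_weq (Tr (bhom_id (L_bc A))) r.
Proof.
by elim: r => [|r IH] p n; [apply: unit_page1 | apply: page_map_bijS].
Qed.

End Unit.

(** * Fibrations of bicomplexes *)

Section TotFibrations.
Variable R : comPzRingType.

(** A witness cycle is indexed by ordinals and an element of the totalisation by
integers, so that lifts are first described one component at a time. *)
Lemma prodm_choice (I : Type) (V : I -> lmodType R)
    (P : forall i, V i -> Prop) :
  (forall i, exists x, P i x) -> exists x : prodm V, forall i, P i (x i).
Proof.
move=> H; exists (fun i => projT1 (cid (H i))) => i.
by case: (cid (H i)).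
Qed.

Lemma cast_section (V : int -> lmodType R) (x : prodm V) m n (e : m = n) :
  cast V e (x m) = x n.
Proof. by case: n / e; rewrite cast_id. Qed.

Lemma Tot_ZFP (X : bicomplex R) (s : nat) (p n : int) (a : Tot_fc X n) :
  a \in ZF (Tot_fc X) s p n <->
  (forall i, p < i -> a i = 0) /\
  (forall i, p - s%:Z < i ->
     bc_d0 X i n (a i) + sgn R n *: bc_d1 X i n (a (i + 1)) = 0).
Proof.
split=> [/ZFP[/submod_ofP Fa /submod_ofP Fda] //|[Fa Fda]].
by apply/ZFP; split; apply/submod_ofP.
Qed.

Variables (X Y : bicomplex R) (f : bhom X Y).

Lemma Tot_ZF_map_surj (s : nat) (p n : int) :
  (forall i (y : Y i n), exists x, f i n x = y) ->
  (forall y, exists x, ZW_map f s p n x = y) ->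
  forall y, exists x, ZF_map (Tot_hom f) s p n x = y.
Proof.
move=> surj surjW [y Zy]; have [Fy dy] := proj1 (Tot_ZFP _ _ _) Zy.
suff [x Zx fx] : exists2 x, x \in ZF (Tot_fc X) s p n &
    forall i, f i n (x i) = y i.
  by exists (Subm Zx); apply/val_inj/prodm_ext.
case: s surjW Zy dy => [_ _ _|k surjW Zy dy].
  pose P i (xi : X i n) := (p < i -> xi = 0) /\ f i n xi = y i.
  have [|x xP] := prodm_choice (P := P).
    move=> i; have [pi|ip] := ltP p i.
      by exists 0; rewrite /P linear0 Fy.
    by have [x fx] := surj _ (y i); exists x; split=> //; rewrite ltNge ip.
  exists x => [|i]; last by case: (xP i).
  by apply: F_ZF0; apply/submod_ofP => i; case: (xP i).
(* The signs turning the equation [d0 a_i + (-1)^n d1 a_{i+1} = 0] of the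
   totalisation into the equation [d0 a_i = d1 a_{i+1}] of witness cycles. *)
pose c j : R := (- sgn R n) ^+ j.
have cK j : c j * c j = 1 by rewrite -exprMn mulrNN sgnK expr1n.
pose b : prodm (fun j : 'I_k.+1 => Y (p - j%:Z) n) :=
  fun j => c j *: y (p - j%:Z).
have cS j : - sgn R n * c j.+1 = c j.
  by rewrite /c exprS mulrA mulrNN sgnK mul1r.
have Wb : ZW_cond b.
  split=> [|j j' e]; rewrite /b linearZZ.
    have d0p i : i = p -> bc_d0 Y i n (y i) = 0.
      move=> ip; have := dy i; rewrite (Fy (i + 1)).
        by rewrite linear0 scaler0 addr0 => -> //; move: ip; clear; lia.
      by move: ip; clear; lia.
    by rewrite d0p ?scaler0 //; clear; rewrite /=; lia.
  rewrite linearZZ /d1sh /= cast_section.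
  have -> : bc_d0 Y (p - j'%:Z) n (y (p - j'%:Z))
       = - sgn R n *: bc_d1 Y (p - j'%:Z) n (y (p - j'%:Z + 1)).
    apply/eqP; rewrite scaleNr -addr_eq0 dy //.
    by move: (ltn_ord j'); clear; lia.
  by rewrite scalerA e mulrC cS.
have [[a Wa] fa] := surjW (Subm (introT (submod_ofP (ZW_closed Y k p n) b) Wb)).
have {}fa (j : 'I_k.+1) : f (p - j%:Z) n (a j) = b j.
  pose Yp (j : 'I_k.+1) := Y (p - j%:Z) n.
  by have := congr1 (fun t => (subm_val t : prodm Yp) j) fa.
have {Wa} [a0 aS] := elimT (submod_ofP _ _) Wa.
pose P i (xi : X i n) := [/\ p < i -> xi = 0, f i n xi = y i &
  forall (j : 'I_k.+1) (e : p - j%:Z = i), xi = cast (X^~ n) e (c j *: a j)].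
(* The lift is given by the lifted witness cycle [a] in the columns from [p] to
   [p - k], and chosen columnwise below. *)
have [|x xP] := prodm_choice (P := P).
  move=> i; have [pi|ip] := ltP p i.
    exists 0; rewrite /P linear0 Fy //; split=> // j e.
    by exfalso; move: pi; clear -e; lia.
  have [ik|ki] := ltP i (p - k%:Z).
    have [x fx] := surj _ (y i); exists x; split=> // [|j e].
      by rewrite ltNge ip.
    by exfalso; move: (ltn_ord j) ik; clear -e; lia.
  have jk : (`|p - i| < k.+1)%N by move: ip ki; clear; lia.
  have e : p - (Ordinal jk)%:Z = i by move: ip; clear; rewrite /=; lia.
  move: (Ordinal jk) e => j {jk ip ki}; case: i /.
  exists (c j *: a j); split=> [||j' e].
  - by rewrite ltNge; clear; lia.
  - by rewrite linearZZ fa scalerA cK scale1r.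
  - have jj' : j' = j by apply: val_inj => /=; move: e; clear; lia.
    by move: e; rewrite jj' => e; rewrite cast_id.
exists x => [|i]; last by case: (xP i).
apply/Tot_ZFP; split=> [i|i ki]; first by case: (xP i).
have [pi|ip] := ltP p i.
  have [[x0 _ _] [x1 _ _]] := (xP i, xP (i + 1)).
  rewrite x0 // x1 ?linear0 ?scaler0 ?addr0 //.
  by move: pi; clear; lia.
have jk : (`|p - i| < k.+1)%N by move: ip ki; clear; lia.
have e : p - (Ordinal jk)%:Z = i by move: ip; clear; rewrite /=; lia.
move: (Ordinal jk) e => j {jk ip ki}; case: i /.
have [_ _ /(_ j erefl) ->] := xP (p - j%:Z).
have [x0 _ xS] := xP (p - j%:Z + 1); rewrite cast_id.
have [j0|j_gt0] := posnP j.
  rewrite x0; last by move: j0; clear; lia.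
  rewrite (linear0 (bc_d1 X _ n)) scaler0 addr0 (linearZZ (bc_d0 X _ n)).
  have -> : j = ord0 by apply: val_inj.
  by rewrite a0 scaler0.
have j'k : (j.-1 < k.+1)%N by move: (ltn_ord j); clear; lia.
pose j' := Ordinal j'k.
have jj' : j = j'.+1 :> nat by rewrite prednK.
rewrite (xS j' (succ_index p jj')).
rewrite (linearZZ (bc_d0 X _ n)) (aS j' j jj').
rewrite (linearZZ (cast (X^~ n) _)) (linearZZ (bc_d1 X _ n)) /=.
rewrite -[c j.-1]cS prednK // [sgn R n *: _]scalerA mulrA mulrN sgnK mulN1r.
by rewrite scaleNr subrr.
Qed.

End TotFibrations.

(** * The Quillen equivalence *)

Theorem theorem2 (R : comPzRingType) (r : nat) (S : {set 'I_r.+1})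
    (S0 : ord0 \in S) (Sr : ord_max \in S)
    (MF : model_structure (fC R)) (MB : model_structure (bC R))
    (hMF : fC_model S MF) (hMB : bC_model S MB) :
  quillen_equivalence MF MB (L_Tot_adj R).
Proof.
have [[weqF fibF] [weqB fibB]] := (hMF, hMB).
have Tot_weq X Y (f : hom X Y) : weq MB f <-> weq MF (fmor (Tot R) f).
  by rewrite weqF weqB.
apply: quillen_equivalence_unit => // [|A]; last by apply/weqF/unit_r_weq.
apply: quillen_adjunction_right => X Y f; last by move=> _ /Tot_weq.
move=> /fibB fS; apply/fibF => s sS p n.
by apply: Tot_ZF_map_surj => [i|]; [apply: (fS ord0) | apply: fS].
Qed.
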